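(* Let $\Gamma'\subset\Gamma$ be elliptic graphs, $\Gamma'$ a proper connected full subgraph, such that every vertex of $\partial_\Gamma(\Gamma')$ is an end-vertex of $\Gamma'$. Let $\ell'\in Supp_j(P_0^{\Gamma'})$ for some $j$, and suppose the set $\pi^{-1}(\ell'):=\{\ell\in Supp(P_0^\Gamma):\ell|_{\Gamma'}=\ell'\}$ is nonempty. Then $$\sum_{\ell\in\pi^{-1}(\ell')}w^\Gamma(\ell)=w^{\Gamma'}(\ell').$$
   Context: For a decorated tree $G$ (vertex set $\mathcal V(G)$, integer decorations $e_v$, genera zero, negative definite form on $L(G)=\mathbb Z\langle E_v\rangle$ with $(E_v,E_v)=e_v$, $(E_v,E_w)=1$ for adjacent $v\ne w$, $0$ otherwise) let $L'(G)$ be the dual lattice, $[l']$ the class in $L'(G)/L(G)$, $E_v^*$ with $(E_v^*,E_w)=-\delta_{vw}$, $\delta_v$ the valency, $E^G=\sum E_v$, $Z_K^G$ with $(Z_K^G,E_v)=e_v+2$, $\chi(l')=-(l',l'-Z_K^G)/2$; $\ge$ coordinatewise, $\prec$ strict in all coordinates, $l>0$ if $l\ge0,l\ne0$, $|l'|$ the support, $\ell|_{G'}$ restriction of coefficients to the vertices of $G'$. $\mathcal S'(G)=\{l':(l',E_v)\le0\ \forall v\}$, $s_h=\min\{l'\in\mathcal S'(G):[l']=h\}$, $Z_{min}(B)$ the minimal nonzero element of $\mathcal S'(B)\cap L(B)$. $Z^G(\mathbf t)=\sum z^G(l')\mathbf t^{l'}$ is the Taylor expansion at $0$ of $\prod_v(1-\mathbf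 t^{E_v^*})^{\delta_v-2}$. $P_0^G(\mathbf t)=\sum_{\ell\in L(G),\ell\not\prec0}w^G(\ell)\mathbf t^\ell$, $w^G(\ell)=z^G(Z^G_K-E^G-\ell)$; $Supp(P_0^G)=\{\ell\not\prec0:w^G(\ell)\ne0\}$. Elliptic graph: $e_v\le-2$ for all $v$ and $\min_{l\in L(G),l>0}\chi(l)=0$. NN-elliptic sequence: $B^G_{-1}=G$, $Z_{B_{-1}}=s_{[Z^G_K]}$, $B^G_0=|Z^G_K-s_{[Z^G_K]}|$; for $j\ge0$, $Z_{B_j}=Z_{min}(B^G_j)$, and if $Z^G_K-\sum_{i=-1}^jZ_{B_i}\ne0$ then $B^G_{j+1}=|Z^G_K-\sum_{i=-1}^jZ_{B_i}|$; $m$ is the index with $Z^G_K=\sum_{i=-1}^mZ_{B_i}$; $C^G_j=\sum_{i=-1}^jZ_{B_i}$. For $\ell\in Supp(P_0^G)$ with $\mathcal V^{<0}(\ell)=\{v:\ell_v<0\}$, the associated cycle is the unique $l'$ with $\ell=Z^G_K-E^G-l'-\sum_{v\in\mathcal V^{<0}(\ell)}m_vE_v$, $l'\le Z^G_K$, $l'_v=(Z^G_K)_v$ on $\mathcal V^{<0}(\ell)$, $m_v\in\mathbb Z_{\ge0}$; $Supp_j(P_0^G)$ is the set of $\ell$ with associated cycle $C^G_j$. $\partial_\Gamma(\Gamma')$ is the set of vertices of $\Gamma'$ adjacent to a vertex of $\Gamma\setminus\Gamma'$; an end-vertex of $\Gamma'$ has valency 1 in $\Gamma'$. *)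

(* Defs.v *)
From HB Require Import structures.
From mathcomp Require Import all_boot all_order all_algebra.
From mathcomp Require Import boolp classical_sets fsbigop.
From Stdlib Require Import ClassicalEpsilon.
Set Implicit Arguments. Unset Strict Implicit. Unset Printing Implicit Defensive.
Import Order.TTheory GRing.Theory Num.Theory.
Local Open Scope ring_scope.

(* An ambient finite vertex type [V] with a (symmetric, irreflexive)
   adjacency relation [adj] and integer decorations [e].  A decorated graph
   is given by a vertex set [S : {set V}]; it is the full subgraph on [S].
   Lattice vectors (in the basis E_v) are functions V -> int / V -> rat;
   only the coordinates on [S] are meaningful. *)
Section DecoratedGraphs.
Variables (V : finType) (adj : rel V) (e : V -> int).

Definition vecQ := {ffun V -> rat}.
Definition vecZ := {ffun V -> int}.
Definition zeroQ : vecQ := [ffun => 0].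
Definition vaddQ (x y : vecQ) : vecQ := [ffun v => x v + y v].
Definition vsubQ (x y : vecQ) : vecQ := [ffun v => x v - y v].

Definition imat (v u : V) : rat :=
  if v == u then (e v)%:~R else if adj v u then 1 else 0.
Definition pairing (S : {set V}) (x y : vecQ) : rat :=
  \sum_(v in S) \sum_(u in S) x v * y u * imat v u.
Definition Ev (w : V) : vecQ := [ffun u => (u == w)%:R].
Definition EG (S : {set V}) : vecQ := [ffun v => (v \in S)%:R].

Definition ratint (q : rat) : bool := denq q == 1.
Definition suppIn (S : {set V}) (x : vecQ) := forall v, v \notin S -> x v = 0.
Definition inL (S : {set V}) (x : vecQ) := suppIn S x /\ forall v, v \in S -> ratint (x v).
Definition inLZ (S : {set V}) (l : vecZ) := forall v, v \notin S -> l v = 0.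
Definition inL' (S : {set V}) (x : vecQ) :=
  suppIn S x /\ forall w, w \in S -> ratint (pairing S x (Ev w)).
Definition sameclass (S : {set V}) (x y : vecQ) :=
  forall v, v \in S -> ratint (x v - y v).

Definition leOn (S : {set V}) (x y : vecQ) := forall v, v \in S -> x v <= y v.
Definition nonzeroOn (S : {set V}) (x : vecQ) := exists v, v \in S /\ x v != 0.
Definition posOn (S : {set V}) (x : vecQ) := leOn S zeroQ x /\ nonzeroOn S x.
Definition support (S : {set V}) (x : vecQ) : {set V} := [set v in S | x v != 0]%SET.

(* E_v^* : the (unique, by nondegeneracy) element with (E_v^*,E_w) = -delta_vw *)
Definition Estar (S : {set V}) (v : V) : vecQ :=
  epsilon (inhabits zeroQ) (fun x : vecQ => suppIn S x /\
    forall w, w \in S -> pairing S x (Ev w) = - (v == w)%:R).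
Definition ZK (S : {set V}) : vecQ :=
  epsilon (inhabits zeroQ) (fun x : vecQ => suppIn S x /\
    forall w, w \in S -> pairing S x (Ev w) = (e w)%:~R + 2).
Definition chi (S : {set V}) (x : vecQ) : rat := - pairing S x (vsubQ x (ZK S)) / 2.

Definition valency (S : {set V}) (v : V) : nat := #|[set u in S | adj v u]%SET|.
Definition Srel (S : {set V}) : rel V := [rel a b | [&& a \in S, b \in S & adj a b]].
Definition connectedG (S : {set V}) :=
  (0 < #|S|)%N /\ forall x y, x \in S -> y \in S -> connect (Srel S) x y.
(* tree: connected with |E| = |V| - 1 (ordered adjacent pairs = 2|E|) *)
Definition treeG (S : {set V}) :=
  connectedG S /\
  #|[set p : V * V | [&& p.1 \in S, p.2 \in S & adj p.1 p.2]]%SET| = (#|S|.-1).*2.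
Definition negdef (S : {set V}) := forall x : vecQ, nonzeroOn S x -> pairing S x x < 0.
Definition decorated_tree (S : {set V}) := treeG S /\ negdef S.

Definition elliptic (S : {set V}) :=
  decorated_tree S /\ (forall v, v \in S -> e v <= -2) /\
  (forall l, inL S l -> posOn S l -> 0 <= chi S l) /\
  (exists l, inL S l /\ posOn S l /\ chi S l = 0).

(* coefficient of x^k in the Taylor expansion of (1-x)^n at 0, n : int *)
Definition taylorc (n : int) (k : nat) : int :=
  if 0 <= n then (-1) ^+ k * ('C(absz n, k))%:Z
  else ('C(k + absz n - 1, k))%:Z.

(* z^G(l') : coefficient of t^{l'} in prod_v (1 - t^{E_v^*})^{delta_v - 2} *)
Definition zcoef (S : {set V}) (x : vecQ) : int :=
  (\sum_(k \in [set k : {ffun V -> nat} | (forall v, v \notin S -> k v = 0%N) /\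
         forall u, u \in S -> \sum_(v in S) (k v)%:R * Estar S v u = x u])
     \prod_(v in S) taylorc ((valency S v)%:Z - 2) (k v))%R.

Definition wcoef (S : {set V}) (l : vecZ) : int :=
  zcoef S [ffun v => if v \in S then ZK S v - 1 - (l v)%:~R else 0].

Definition notprec0 (S : {set V}) (l : vecZ) := ~ (forall v, v \in S -> l v < 0).
Definition SuppP0 (S : {set V}) (l : vecZ) := inLZ S l /\ notprec0 S l /\ wcoef S l != 0.

Definition inSp (S : {set V}) (x : vecQ) :=
  inL' S x /\ forall v, v \in S -> pairing S x (Ev v) <= 0.
Definition sZK (S : {set V}) : vecQ :=
  epsilon (inhabits zeroQ) (fun x : vecQ => inSp S x /\ sameclass S x (ZK S) /\
    forall y, inSp S y -> sameclass S y (ZK S) -> leOn S x y).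
Definition Zmin (B : {set V}) : vecQ :=
  epsilon (inhabits zeroQ) (fun x : vecQ => inL B x /\ inSp B x /\ nonzeroOn B x /\
    forall y, inL B y -> inSp B y -> nonzeroOn B y -> leOn B x y).

(* Cseq S k = C^G_{k-1}: C_{-1} = s_{[Z_K]}, C_j = C_{j-1} + Z_min(B_j),
   B_j = |Z_K - C_{j-1}|; the sequence is stopped (kept constant) once
   C_m = Z_K. *)
Fixpoint Cseq (S : {set V}) (k : nat) : vecQ :=
  match k with
  | 0%N => sZK S
  | k'.+1 => let C := Cseq S k' in
      if [forall v in S, ZK S v == C v] then C
      else vaddQ C (Zmin (support S (vsubQ (ZK S) C)))
  end.

Definition assoc_cycle (S : {set V}) (l : vecZ) (c : vecQ) :=
  (exists m : V -> nat, forall v, v \in S ->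
      (l v)%:~R = ZK S v - 1 - c v - (if l v < 0 then (m v)%:R else 0)) /\
  leOn S c (ZK S) /\
  (forall v, v \in S -> l v < 0 -> c v = ZK S v).

(* l \in Supp_j(P_0^G), with k = j + 1 *)
Definition SuppP0j (S : {set V}) (k : nat) (l : vecZ) :=
  SuppP0 S l /\ assoc_cycle S l (Cseq S k).

Definition boundary (S S' : {set V}) : {set V} :=
  [set v in S' | [exists u in S :\: S', adj v u]]%SET.

Definition piinv (S S' : {set V}) (l' : vecZ) (l : vecZ) :=
  SuppP0 S l /\ forall v, v \in S' -> l v = l' v.

End DecoratedGraphs.

(* Main.v *)
Require Import Defs.
From HB Require Import structures.
From mathcomp Require Import all_boot all_order all_algebra.
From mathcomp Require Import boolp classical_sets functions cardinality fsbigop.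
From mathcomp Require Import zify ring lra.
From Stdlib Require Import ClassicalEpsilon.
Set Implicit Arguments. Unset Strict Implicit. Unset Printing Implicit Defensive.
Import Order.TTheory GRing.Theory Num.Theory.
Import mathcomp.boot.fintype mathcomp.boot.finset.
Local Open Scope ring_scope.

(* Since k_v = -(x, E_v) recovers the exponents of x = sum_v k_v E_v^*, the weight w(l) is the product
   over v of the coefficient of s^{(l, E_v) + delta_v - 2} in (1 - s)^{delta_v - 2}.  Summing one
   coordinate l_v over all integers <= b multiplies the generating function of the factor at the
   neighbour of v by 1/(1 - s).  Hence the vertices of Gamma \ Gamma' can be summed out from the
   leaves towards Gamma', provided that at each vertex v the admissible values of l_v form a half
   line {l_v <= g_v(l_{parent v})}.  What is left at a boundary vertex is the indicator function of
   an inequality, which holds as soon as some l restricts to l'.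
   The half-line property is where ellipticity enters.  Take D with chi(D) = 0 and positive
   coefficients outside the branch of v: from chi(D + x) >= 0 one gets chi(x) >= (D, x) >= x_v
   for x >= 0 on the branch.  So Laufer's computation sequence started at E_v never adds E_v a second
   time, and it ends in an anti-nef cycle x with x_v = 1; subtracting such cycles from an
   admissible l shows that admissibility is inherited by l_v - 1. *)

(** * Intersection form: symmetry, solvability and sign consequences of negative definiteness *)

Section Intersection.
Variables (V : finType) (adj : rel V) (e : V -> int).
Implicit Types (S T : {set V}).
Hypothesis adjC : symmetric adj.
Hypothesis adjI : irreflexive adj.

(** The number (x, E_v) in coordinates, over any commutative ring so that integral and rational
    cycles share the same lemmas. *)
Definition intersection_number (R : comPzRingType) (S : {set V}) (x : V -> R) (v : V) : R :=
  (e v)%:~R * x v + \sum_(u in S | adj v u) x u.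

Local Notation inter := intersection_number.

Lemma imat_sum S (x : V -> rat) w : w \in S ->
  \sum_(v in S) x v * imat adj e v w = inter S x w.
Proof.
move=> wS; rewrite (bigD1 w) //= /imat eqxx mulrC; congr (_ + _).
rewrite [RHS]big_mkcondr /= [RHS](bigD1 w) //= adjI add0r.
apply: eq_bigr => v /andP[vS /negbTE vw]; rewrite vw [adj w v]adjC.
by case: ifP => _; rewrite ?mulr1 ?mulr0.
Qed.

Lemma pairingE S x y : pairing adj e S x y = \sum_(w in S) y w * inter S x w.
Proof.
rewrite /pairing exchange_big /=; apply: eq_bigr => w wS.
rewrite -imat_sum // mulr_sumr; apply: eq_bigr => v _.
by rewrite mulrCA mulrA.
Qed.

Lemma pairing_Ev S x w : w \in S -> pairing adj e S x (Ev w) = inter S x w.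
Proof.
move=> wS; rewrite pairingE (bigD1 w) //= ffunE eqxx mul1r big1 ?addr0 // => v.
by move=> /andP[_ /negbTE vw]; rewrite ffunE vw mul0r.
Qed.

Lemma inter_sym (R : comPzRingType) S (x y : V -> R) :
  \sum_(w in S) y w * inter S x w = \sum_(w in S) x w * inter S y w.
Proof.
rewrite /inter; under eq_bigr do rewrite mulrDr mulr_sumr.
under [RHS]eq_bigr do rewrite mulrDr mulr_sumr.
rewrite !big_split /=; congr (_ + _); first by apply: eq_bigr => w _; ring.
under eq_bigr do rewrite big_mkcondr.
under [RHS]eq_bigr do rewrite big_mkcondr.
rewrite exchange_big /=; apply: eq_bigr => w _; apply: eq_bigr => v _.
by rewrite adjC; case: ifP => // _; rewrite mulrC.
Qed.

Lemma pairingC S x y : pairing adj e S x y = pairing adj e S y x.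
Proof. by rewrite !pairingE inter_sym. Qed.

Lemma eq_inter (R : comPzRingType) S (x y : V -> R) v :
  x v = y v -> (forall u, u \in S -> adj v u -> x u = y u) ->
  inter S x v = inter S y v.
Proof.
move=> xyv xyS; rewrite /inter xyv; congr (_ + _).
by apply: eq_bigr => u /andP[uS vu]; apply: xyS.
Qed.

Lemma inter_lin (R : comPzRingType) S (a b : R) (x y z : V -> R) v :
  (forall u, z u = a * x u + b * y u) ->
  inter S z v = a * inter S x v + b * inter S y v.
Proof.
move=> zE; rewrite /inter zE; under eq_bigr do rewrite zE.
by rewrite big_split /= -!mulr_sumr; ring.
Qed.

Lemma inter_intr S (l : V -> int) v :
  inter S (fun u => (l u)%:~R : rat) v = (inter S l v)%:~R.
Proof. by rewrite /inter intrD intrM intz rmorph_sum. Qed.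

Lemma inter_intrE S (x : V -> rat) (l : V -> int) v : v \in S ->
  (forall u, u \in S -> x u = (l u)%:~R) -> inter S x v = (inter S l v)%:~R.
Proof.
by move=> vS xl; rewrite -inter_intr; apply: eq_inter => [|u uS _]; apply: xl.
Qed.

Lemma inter_subset (R : comPzRingType) (S T : {set V}) (x : V -> R) v :
  T \subset S -> (forall u, u \in S -> u \notin T -> x u = 0) ->
  inter S x v = inter T x v.
Proof.
move=> TS x0; rewrite /inter; congr (_ + _).
rewrite (bigID [in T]) /= [X in _ + X]big1 ?addr0; last first.
  by move=> u /andP[/andP[uS _] uT]; apply: x0.
apply: eq_bigl => u; rewrite andbAC; case: (boolP (u \in T)) => [uT|]; last by rewrite andbF.
by rewrite (subsetP TS).
Qed.

Lemma negdef_sub (S T : {set V}) : T \subset S -> negdef adj e S -> negdef adj e T.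
Proof.
move=> TS nS x [v [vT xv]].
pose y : vecQ V := [ffun u => if u \in T then x u else 0].
have := nS y; rewrite !pairingE.
have -> : \sum_(w in S) y w * inter S y w = \sum_(w in T) x w * inter T x w.
  rewrite (bigID [in T]) /= [X in _ + X]big1 ?addr0; last first.
    by move=> u /andP[_ /negbTE uT]; rewrite ffunE uT mul0r.
  rewrite (eq_bigl [in T]); last first.
    move=> u /=; case: (boolP (u \in T)) => [uT|]; last by rewrite andbF.
    by rewrite (subsetP TS).
  apply: eq_bigr => u uT; rewrite ffunE uT; congr (_ * _).
  rewrite (@inter_subset _ S T) //; last by move=> w _ /negbTE wT; rewrite ffunE wT.
  by apply: eq_inter => [|w wT _]; rewrite ffunE ?uT ?wT.
apply; exists v; rewrite ffunE vT; split=> //.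
exact: (subsetP TS).
Qed.

(** Here (x, x) = sum_w x_w (x, E_w) = 0, which negative definiteness allows only for x = 0 on S. *)
Lemma negdef_inter0 S (x : V -> rat) : negdef adj e S ->
  (forall w, w \in S -> inter S x w = 0) -> forall w, w \in S -> x w = 0.
Proof.
move=> nS x0 w wS; apply/eqP/negP => /negP xw.
have := nS [ffun v => x v]; rewrite pairingE big1 ?ltxx.
  by move=> /(_ _)/wrap[] //; exists w; rewrite ffunE.
move=> v vS; rewrite (@eq_inter _ S _ x) ?x0 ?mulr0 // => [|u uS _]; exact: ffunE.
Qed.

Lemma negdef_solve S (f : V -> rat) : negdef adj e S ->
  exists x : vecQ V, suppIn S x /\ forall w, w \in S -> inter S x w = f w.
Proof.
move=> nS.
(* The intersection matrix of S, padded by the identity outside S: all of V can serve as index set,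
   and a right-hand side supported on S forces the solution to vanish off S. *)
pose A : 'M[rat]_#|V| := \matrix_(i, j)
  let v := enum_val i in let w := enum_val j in
  if w \in S then (if v \in S then imat adj e v w else 0) else (v == w)%:R.
pose vec (r : 'rV[rat]_#|V|) : vecQ V := [ffun v => r 0 (enum_rank v)].
have AE r w : (r *m A) 0 (enum_rank w) =
    if w \in S then inter S (vec r) w else vec r w.
  rewrite mxE (reindex_onto enum_rank enum_val) /=; last by move=> i _; rewrite enum_valK.
  under eq_bigl do rewrite enum_rankK eqxx.
  under eq_bigr do rewrite mxE !enum_rankK.
  case: ifP => wS.
    rewrite -imat_sum // [RHS]big_mkcond; apply: eq_bigr => v _.
    by rewrite ffunE /= wS; case: (v \in S); rewrite ?mulr0.
  under eq_bigr do rewrite /= wS.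
  rewrite (bigD1 w) //= eqxx mulr1 ffunE big1 ?addr0 // => v /negbTE ->.
  by rewrite mulr0.
have uA : A \in unitmx.
  rewrite -row_free_unit -kermx_eq0; apply/rowV0P => r /sub_kermxP rA.
  have r0 w : (if w \in S then inter S (vec r) w else vec r w) = 0.
    by rewrite -AE rA mxE.
  have v0 w : vec r w = 0.
    case: (boolP (w \in S)) => wS; last by have := r0 w; rewrite (negbTE wS).
    by apply: (negdef_inter0 nS _ wS) => u uS; move: (r0 u); rewrite uS.
  apply/rowP => i; rewrite mxE -(enum_valK i).
  by have := v0 (enum_val i); rewrite ffunE.
pose b : 'rV[rat]_#|V| := \row_i (if enum_val i \in S then f (enum_val i) else 0).
exists (vec (b *m invmx A)); split=> [v|w] H.
  by have := AE (b *m invmx A) v; rewrite (negbTE H) => <-;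
    rewrite mulmxKV // mxE enum_rankK (negbTE H).
by have := AE (b *m invmx A) w; rewrite H => <-; rewrite mulmxKV // mxE enum_rankK H.
Qed.

(** Write x = p - n with p, n >= 0 of disjoint supports. Then (n, n) = (n, p) - (n, x) >= 0, so n =
    0. *)
Lemma negdef_ge0 S (x : V -> rat) : negdef adj e S ->
  (forall w, w \in S -> inter S x w <= 0) -> forall w, w \in S -> 0 <= x w.
Proof.
move=> nS xle w wS; rewrite leNgt; apply/negP => xw.
pose p v := Num.max (x v) 0; pose n v := Num.max (- x v) 0.
have n_ge0 v : 0 <= n v by rewrite /n le_max lexx orbT.
have p_ge0 v : 0 <= p v by rewrite /p le_max lexx orbT.
have pn v : p v * n v = 0 by rewrite /p /n; case: (lerP (x v) 0) => ?; rewrite ?mul0r // max_r ?mulr0 //; lra.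
have xE v : x v = p v - n v.
  by rewrite /p /n; case: (lerP (x v) 0) => ?; [rewrite max_l|rewrite max_r]; lra.
have := nS [ffun v => n v]; rewrite pairingE.
have -> : \sum_(v in S) [ffun v => n v] v * inter S [ffun v => n v] v =
   \sum_(v in S) n v * inter S p v - \sum_(v in S) n v * inter S x v.
  rewrite -sumrB; apply: eq_bigr => v vS; rewrite ffunE -mulrBr; congr (_ * _).
  have -> : inter S [ffun v => n v] v = inter S n v.
    by apply: eq_inter => [|u uS _]; rewrite ffunE.
  rewrite (@inter_lin _ S 1 (-1) p x) ?mul1r ?mulN1r // => u.
  by rewrite xE; ring.
move=> /(_ _)/wrap[].
  by exists w; split=> //; rewrite ffunE /n gt_eqF // lt_max; apply/orP; left; lra.
apply/negP; rewrite -leNgt subr_ge0; apply: (@le_trans _ _ 0).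
  by apply: sumr_le0 => v vS; rewrite mulr_ge0_le0 ?xle.
apply: sumr_ge0 => v vS; rewrite /inter mulrDr mulrCA [n v * p v]mulrC pn mulr0 add0r.
by rewrite mulr_ge0 // sumr_ge0.
Qed.

(** Once x >= 0, a zero at a vertex a together with (x, E_a) <= 0 forces zeros at all neighbours of
    a; by connectedness x would vanish on S, against the strict inequality. *)
Lemma negdef_gt0 S (x : V -> rat) : negdef adj e S -> connectedG adj S ->
  (forall w, w \in S -> inter S x w <= 0) ->
  (exists2 w, w \in S & inter S x w < 0) -> forall w, w \in S -> 0 < x w.
Proof.
move=> nS [_ cS] xle [w0 w0S xw0] w wS.
have x0 := negdef_ge0 nS xle.
rewrite lt_neqAle x0 // andbT; apply/negP => /eqP xw.
have step a b : x a = 0 -> Srel adj S a b -> x b = 0.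
  move=> xa /and3P[aS bS ab]; apply/eqP; rewrite eq_le x0 // andbT.
  have := xle a aS; rewrite /inter xa mulr0 add0r; apply: le_trans.
  by rewrite (bigD1 b) ?bS //= lerDl sumr_ge0 // => u /andP[/andP[/x0]].
have xall u : u \in S -> x u = 0.
  move=> uS; have /connectP[p + ->] := cS w u wS uS.
  elim: p w xw {uS wS} => [|c p IH] w xw //= /andP[wc cp].
  by apply: IH cp; rewrite (step w c).
move: xw0; rewrite /inter xall // mulr0 add0r big1 ?ltxx // => u /andP[uS _].
exact: xall.
Qed.

End Intersection.

(** * Product formula for the weights w(l) *)

Definition taylorz (n k : int) : int := if k is Posz k' then taylorc n k' else 0.

Section Coefficients.
Variables (V : finType) (adj : rel V) (e : V -> int).
Implicit Types (S T : {set V}).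
Hypothesis adjC : symmetric adj.
Hypothesis adjI : irreflexive adj.
Local Notation inter := (intersection_number adj e).

Lemma inter_sum (R : comPzRingType) S (I : finType) (P : pred I) (c : I -> R)
    (F : I -> V -> R) w :
  inter S (fun u => \sum_(v | P v) c v * F v u) w = \sum_(v | P v) c v * inter S (F v) w.
Proof.
rewrite /intersection_number.
under [RHS]eq_bigr do rewrite mulrDr mulr_sumr.
rewrite big_split /= mulr_sumr exchange_big; congr (_ + _).
by apply: eq_bigr => v _; rewrite mulrCA.
Qed.

Lemma inter1 S w :
  inter S (fun _ => 1 : rat) w = (e w)%:~R + (valency adj S w)%:R.
Proof.
rewrite /intersection_number mulr1 -sumr_const; congr (_ + _).
by apply: eq_bigl => u; rewrite inE.
Qed.

(** [ZK] is chosen by [epsilon]; solvability of the adjunction equations is what gives access to its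
    defining property. The same holds for [Estar] below. *)
Lemma ZK_inter S w : negdef adj e S -> w \in S ->
  inter S (ZK adj e S) w = (e w)%:~R + 2.
Proof.
move=> nS wS; have [x [xS xE]] := negdef_solve adjC adjI (fun w => (e w)%:~R + 2) nS.
have ex : exists x : vecQ V, suppIn S x /\
    forall w, w \in S -> pairing adj e S x (Ev w) = (e w)%:~R + 2.
  by exists x; split=> // u uS; rewrite pairing_Ev // xE.
by have [_ /(_ w wS)] := epsilon_spec (inhabits (zeroQ V)) _ ex; rewrite pairing_Ev.
Qed.

Lemma Estar_inter S v w : negdef adj e S -> w \in S ->
  inter S (Estar adj e S v) w = - (v == w)%:R.
Proof.
move=> nS wS; have [x [xS xE]] := negdef_solve adjC adjI (fun w => - (v == w)%:R) nS.
have ex : exists x : vecQ V, suppIn S x /\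
    forall w, w \in S -> pairing adj e S x (Ev w) = - (v == w)%:R.
  by exists x; split=> // u uS; rewrite pairing_Ev // xE.
by have [_ /(_ w wS)] := epsilon_spec (inhabits (zeroQ V)) _ ex; rewrite pairing_Ev.
Qed.

(** For x = Z_K - E - l this is -(x, E_v), because (Z_K - E, E_v) = 2 - delta_v. *)
Definition expo S (l : V -> int) (v : V) : int :=
  inter S l v + (valency adj S v)%:Z - 2.

(* The exponents of the t^{E_v^*} are recovered from x = sum k_v E_v^* as k_v = -(x, E_v). *)
Lemma wcoefE S (l : vecZ V) : negdef adj e S ->
  wcoef adj e S l = \prod_(v in S) taylorz ((valency adj S v)%:Z - 2) (expo S l v).
Proof.
move=> nS; rewrite /wcoef /zcoef; set x := finfun _; set A := mkset _.
have xE w : w \in S -> inter S x w = - (expo S l w)%:~R.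
  move=> wS; pose y u := ZK adj e S u - 1.
  have -> : inter S x w = inter S (fun u => 1 * y u + (-1) * (l u)%:~R) w.
    by apply: eq_inter => [|u uS _]; rewrite ffunE ?wS ?uS /y; ring.
  rewrite (@inter_lin _ _ e _ S 1 (-1) y (fun u => (l u)%:~R)) //.
  rewrite (@inter_lin _ _ e _ S 1 (-1) (ZK adj e S) (fun=> 1)); last first.
    by move=> u; rewrite /y; ring.
  rewrite inter_intr ZK_inter // inter1 /expo !rmorphB !rmorphD /=; ring.
have sumE (k : {ffun V -> nat}) w : w \in S ->
    inter S (fun u => \sum_(v in S) (k v)%:R * Estar adj e S v u) w = - (k w)%:R.
  move=> wS; rewrite inter_sum (bigD1 w) //= Estar_inter // eqxx big1.
    by rewrite addr0 mulrN1.
  by move=> v /andP[_ /negbTE vw]; rewrite Estar_inter // vw oppr0 mulr0.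
have AE k : A k <-> (forall v, v \notin S -> k v = 0%N) /\
    forall v, v \in S -> expo S l v = (k v)%:Z.
  split=> -[k0 kE]; split=> // v vS.
    apply/eqP; rewrite -(eqr_int rat) -eqr_opp -xE // -sumE //.
    by apply/eqP/eq_inter => [|u uS _]; rewrite kE.
  apply/eqP; rewrite -subr_eq0; apply/eqP.
  apply: (@negdef_inter0 _ _ e adjC adjI S (fun u =>
    \sum_(v in S) (k v)%:R * Estar adj e S v u - x u) nS _ v vS) => w wS /=.
  rewrite (@inter_lin _ _ e _ S 1 (-1) (fun u => \sum_(v in S) (k v)%:R * Estar adj e S v u) x).
    by rewrite sumE // xE // kE //; ring.
  by move=> u; ring.
(* If all exponents are nonnegative, [A] consists of one exponent vector; otherwise [A] is empty,
   which matches the value 0 of [taylorz] at negative arguments. *)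
have [/forallP Kge|] := boolP [forall v in S, 0 <= expo S l v].
  pose k0 : {ffun V -> nat} := [ffun v => if v \in S then absz (expo S l v) else 0%N].
  have -> : A = [set k0]%classic.
    apply/seteqP; split=> k /= => [/AE[k0E kE]|->].
      apply/ffunP => v; rewrite ffunE; case: ifP => [vS|/negbT /k0E //].
      by rewrite kE.
    apply/AE; split=> v vS; rewrite ffunE ?(negbTE vS) // vS gez0_abs //.
    exact: (implyP (Kge v)).
  rewrite fsbig_set1; apply: eq_bigr => v vS; rewrite ffunE vS.
  by move/implyP: (Kge v) => /(_ vS); case: (expo S l v).
rewrite negb_forall => /existsP[v]; rewrite negb_imply -ltNge => /andP[vS Kv].
have -> : A = classical_sets.set0.
  rewrite -classical_sets.subset0 => k /AE[_ /(_ v vS)] Kk.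
  by move: Kv; rewrite Kk.
rewrite fsbig_set0 (bigD1 v) //= /taylorz.
by case: (expo S l v) Kv => // n _; rewrite mul0r.
Qed.

Lemma wcoef_expo_ge0 S (l : vecZ V) v : negdef adj e S ->
  wcoef adj e S l != 0 -> v \in S -> 0 <= expo S l v.
Proof.
move=> nS + vS; rewrite wcoefE // (bigD1 v) //= mulf_eq0 negb_or => /andP[+ _].
by case: (expo S l v).
Qed.

End Coefficients.

(** * Orientation of the edges of a tree towards a subtree *)

Section Trees.
Variables (V : finType) (adj : rel V).
Implicit Types (S T A : {set V}).
Hypothesis adjC : symmetric adj.

Lemma connected_exit S A a v : connectedG adj S -> A \subset S ->
  a \in A -> v \in S -> v \notin A ->
  exists x y, [/\ x \in A, y \in S, y \notin A & adj x y].
Proof.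
move=> [_ cS] AS aA vS vA.
have /connectP[p + vE] := cS a v (subsetP AS _ aA) vS.
elim: p a aA vE => [|c p IH] a aA /= vE; first by rewrite vE aA in vA.
case/andP=> /and3P[_ cS' ac] cp; have [cA|cA] := boolP (c \in A).
  exact: (IH c).
by exists a, c.
Qed.

(** Orients S towards T. The rank [d] only has to drop along [par]; it replaces the distance to
    T. *)
Definition parent_fun S T (par : V -> V) (d : V -> nat) :=
  forall v, v \in S -> v \notin T -> [/\ par v \in S, adj v (par v) & (d (par v) < d v)%N].

Lemma exists_parent_fun S T : connectedG adj S -> T \subset S -> (0 < #|T|)%N ->
  exists par d, parent_fun S T par d.
Proof.
move=> cS TS /card_gt0P[t tT].
suff main n : forall A, T \subset A -> A \subset S -> #|S :\: A| = n ->
    (exists par d, parent_fun A T par d) -> exists par d, parent_fun S T par d.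
  apply: (main _ T) => //; exists id, (fun=> 0%N) => v vT; by rewrite vT.
elim: n => [|n IH] A TA AS SA [par [d pd]].
  exists par, d; suff -> : S = A by [].
  by apply/eqP; rewrite eqEsubset AS andbT -setD_eq0 -cards_eq0 SA.
have [v] : exists v, v \in S :\: A by apply/card_gt0P; rewrite SA.
rewrite inE => /andP[vA vS].
have [x [y [xA yS yA xy]]] := connected_exit cS AS (subsetP TA _ tT) vS vA.
apply: (IH (y |: A)).
- exact: subset_trans TA (subsetUr _ _).
- by rewrite subUset sub1set yS.
- apply/eqP; rewrite -eqSS -SA (cardsD1 y (S :\: A)) inE yA yS add1n eqSS; apply/eqP.
  by apply: eq_card => u; rewrite !inE negb_or andbA.
pose par' u := if u == y then x else par u.
(* The new vertex y gets a rank above every earlier one. *)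
pose d' u := if u == y then (\sum_(w in V) d w).+1 else d u.
exists par', d' => u; rewrite in_setU1 /par' /d'.
have [-> _ yT|_ /= uA uT] := eqVneq u y.
  rewrite in_setU1 xA orbT adjC xy; have [xy'|xy'] := eqVneq x y.
    by rewrite -xy' xA in yA.
  by rewrite ltnS (bigD1 x) //= leq_addr.
have [puA upu dpu] := pd u uA uT; rewrite in_setU1 puA orbT; split=> //.
by case: eqVneq => // puy; rewrite -puy puA in yA.
Qed.

(* Edge count: the edges {v, par v} are #|S :\: T| new edges besides those of T. *)
Lemma tree_edges S T par d : treeG adj S -> treeG adj T -> T \subset S ->
  parent_fun S T par d ->
  forall v w, v \in S -> w \in S -> adj v w ->
  [\/ v \in T /\ w \in T, v \notin T /\ w = par v | w \notin T /\ v = par w].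
Proof.
move=> [[S0 _] ES] [[T0 _] ET] TS pd.
pose edges A := [set p : V * V | [&& p.1 \in A, p.2 \in A & adj p.1 p.2]]%SET.
rewrite -/(edges S) in ES; rewrite -/(edges T) in ET.
(* The two orientations of the edges {v, par v}. They are disjoint from each other, by the rank, and
   from the edges inside T, so equal cardinality shows that nothing else is left in S. *)
pose up := [set (v, par v) | v in S :\: T].
pose down := [set (par v, v) | v in S :\: T].
have cup : #|up| = #|S :\: T| by rewrite card_imset // => a b [].
have cdown : #|down| = #|S :\: T| by rewrite card_imset // => a b [].
have upP p : p \in up -> [/\ p.1 \in S, p.1 \notin T & p.2 = par p.1].
  by case/imsetP=> v /setDP[vS vT] ->.
have downP p : p \in down -> [/\ p.2 \in S, p.2 \notin T & p.1 = par p.2].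
  by case/imsetP=> v /setDP[vS vT] ->.
have dis1 : edges T :&: up = set0.
  apply/setP => p; rewrite !inE; apply/negP => /andP[/and3P[p1 _ _] /upP[_]].
  by rewrite p1.
have dis2 : (edges T :|: up) :&: down = set0.
  apply/setP => p; rewrite !in_setI in_setU in_set0; apply/negP.
  move=> /andP[/orP[pT|/upP[p1S p1T p1E]] /downP[p2S p2T p2E]].
    by move: pT; rewrite inE (negbTE p2T) andbF.
  have [_ _] := pd _ p1S p1T; have [_ _] := pd _ p2S p2T.
  by rewrite -p2E -p1E => d1 /(ltn_trans d1); rewrite ltnn.
have sub : edges T :|: up :|: down \subset edges S.
  apply/subsetP => p; rewrite !in_setU => /orP[/orP[|/upP[pS pT pE]]|/downP[pS pT pE]].
  - by rewrite !inE => /and3P[/(subsetP TS)-> /(subsetP TS)-> ->].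
  - by have [? ? _] := pd _ pS pT; rewrite inE pE; apply/and3P.
  - by have [? ? _] := pd _ pS pT; rewrite inE pE adjC; apply/and3P.
have card_eq : #|edges T :|: up :|: down| = #|edges S|.
  rewrite cardsU dis2 cards0 subn0 cardsU dis1 cards0 subn0 cup cdown ET ES.
  have := cardsD S T; rewrite (setIidPr TS) => ->.
  by have := subset_leq_card TS; lia.
have /setP eq_edges : edges T :|: up :|: down = edges S.
  by apply/eqP; rewrite eqEcard sub card_eq leqnn.
move=> v w vS wS vw; have := eq_edges (v, w).
rewrite !in_setU [in RHS]inE vS wS vw.
move=> /orP[/orP[|/upP[/= ? ? ->]]|/downP[/= ? ? ->]].
- by rewrite inE => /and3P[]; constructor 1.
- by constructor 2.
- by constructor 3.
Qed.

End Trees.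

(** * Euler characteristic of integral cycles and computation sequences *)

Section EulerCharacteristic.
Variables (V : finType) (adj : rel V) (e : V -> int).
Implicit Types (S T X Y : {set V}) (l : V -> int).
Hypothesis adjC : symmetric adj.
Hypothesis adjI : irreflexive adj.
Local Notation inter := (intersection_number adj e).

Definition nonneg_on S l := (forall v, 0 <= l v) /\ (forall v, v \notin S -> l v = 0).

Definition addE l (v : V) : V -> int := fun u => l u + (u == v)%:R.

Lemma nonneg_addE S l v : nonneg_on S l -> v \in S -> nonneg_on S (addE l v).
Proof.
move=> [l0 lS] vS; split=> u; first by rewrite addr_ge0 // ler0n.
by move=> uS; rewrite /addE lS // add0r; case: eqVneq uS => // ->; rewrite vS.
Qed.

Lemma inter_ge0 S l v : (forall u, 0 <= l u) -> l v = 0 -> 0 <= inter S l v.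
Proof. by move=> l0 lv; rewrite /intersection_number lv mulr0 add0r sumr_ge0. Qed.

Lemma inter_gt0 S l v u : (forall w, 0 <= l w) -> l v = 0 ->
  u \in S -> adj v u -> 0 < l u -> 0 < inter S l v.
Proof.
move=> l0 lv uS vu lu; rewrite /intersection_number lv mulr0 add0r (bigD1 u) ?uS //=.
by rewrite ltr_pwDl // sumr_ge0.
Qed.

(** Twice chi(l), that is -(l, l - Z_K) with (Z_K, E_v) replaced by e_v + 2, so that it stays in the
    integers. *)
Definition chi2 S l : int := \sum_(v in S) l v * (e v + 2 - inter S l v).

Lemma chiE S (x : vecQ V) l : negdef adj e S -> (forall v, v \in S -> x v = (l v)%:~R) ->
  chi adj e S x = (chi2 S l)%:~R / 2.
Proof.
move=> nS xl; rewrite /chi pairingC // pairingE //; congr (_ / _).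
rewrite -sumrN /chi2 rmorph_sum; apply: eq_bigr => v vS /=.
rewrite (@inter_lin _ _ e _ S 1 (-1) x (ZK adj e S)); last by move=> u; rewrite ffunE; ring.
rewrite (inter_intrE adj e vS xl) ZK_inter // xl //.
by move: (inter S l v) => i; rewrite intrM intrB intrD; ring.
Qed.

Lemma chi2D S a b l : (forall v, l v = a v + b v) ->
  chi2 S l = chi2 S a + chi2 S b - 2 * \sum_(v in S) b v * inter S a v.
Proof.
move=> lE; have sym := inter_sym e adjC S a b.
pose sab := \sum_(v in S) b v * inter S a v.
rewrite mulr2n mulrDl mul1r {2}sym /chi2 -!big_split -sumrB /=.
apply: eq_bigr => v _; rewrite lE (@inter_lin _ _ e _ S 1 1 a b); first by ring.
by move=> u; rewrite lE; ring.
Qed.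

Lemma chi2_E S v : v \in S -> chi2 S (addE (fun=> 0) v) = 2.
Proof.
move=> vS; rewrite /chi2 (bigD1 v) //= big1 ?addr0; last first.
  by move=> u /andP[_ /negbTE uv]; rewrite /addE uv addr0 mul0r.
rewrite /addE eqxx add0r mul1r /intersection_number eqxx add0r mulr1 intz big1 ?addr0.
  by ring.
by move=> u /andP[_ vu]; case: eqVneq vu => // ->; rewrite adjI.
Qed.

Lemma chi2_addE S l v : v \in S -> chi2 S (addE l v) = chi2 S l + 2 - 2 * inter S l v.
Proof.
move=> vS; rewrite (@chi2D _ l (addE (fun=> 0) v)) ?chi2_E //; last first.
  by move=> u; rewrite /addE add0r.
congr (_ - 2 * _); rewrite (bigD1 v) //= big1 ?addr0 /addE ?eqxx ?add0r ?mul1r //.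
by move=> u /andP[_ /negbTE uv]; rewrite uv add0r mul0r.
Qed.

Lemma chi2_subset S T l : T \subset S -> (forall v, v \notin T -> l v = 0) ->
  chi2 S l = chi2 T l.
Proof.
move=> TS l0; rewrite /chi2 (bigID [in T]) /= [X in _ + X]big1 ?addr0; last first.
  by move=> u /andP[_ uT]; rewrite l0 // mul0r.
rewrite (eq_bigl [in T]); last first.
  move=> u /=; case: (boolP (u \in T)) => [uT|]; last by rewrite andbF.
  by rewrite (subsetP TS).
by apply: eq_bigr => u uT; rewrite (@inter_subset _ adj e _ S T) // => w _; apply: l0.
Qed.

Lemma elliptic_chi2_ge0 S l : elliptic adj e S -> nonneg_on S l -> 0 <= chi2 S l.
Proof.
move=> [[_ nS] [_ [chi_ge0 _]]] [l0 lS].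
pose x : vecQ V := [ffun v => (l v)%:~R].
have [/existsP[v /andP[vS lv]]|] := boolP [exists v in S, l v != 0]; last first.
  rewrite negb_exists => /forallP lz; rewrite /chi2 big1 // => v vS.
  by have := lz v; rewrite vS negbK => /eqP ->; rewrite mul0r.
have : 0 <= chi adj e S x.
  apply: chi_ge0; split.
  - by move=> u uS; rewrite ffunE lS.
  - by move=> u _; rewrite /ratint ffunE denq_int.
  - by move=> u _; rewrite !ffunE ler0z.
  - by exists v; rewrite ffunE intr_eq0.
rewrite (@chiE S x l) //; last by move=> u _; rewrite ffunE.
by rewrite pmulr_lge0 ?invr_gt0 // ler0z.
Qed.

Lemma elliptic_cycle S : elliptic adj e S ->
  exists l, [/\ nonneg_on S l, chi2 S l = 0 & exists2 v, v \in S & 0 < l v].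
Proof.
move=> [[_ nS] [_ [_ [x [[xS xint] [[x0 [v [vS xv]]] chix]]]]]].
have xE u : x u = (numq (x u))%:~R.
  have [uS|uS] := boolP (u \in S); last by rewrite xS.
  by rewrite -[LHS]divq_num_den (eqP (xint u uS)) divr1.
have x_ge0 u : 0 <= x u.
  have [uS|uS] := boolP (u \in S); last by rewrite xS.
  by have := x0 u uS; rewrite ffunE.
exists (fun u => numq (x u)); split.
- by split=> u; [rewrite numq_ge0 | move=> /xS ->].
- move: chix; rewrite (@chiE _ _ (fun u => numq (x u))) // => /eqP.
  by rewrite mulf_eq0 invr_eq0 orbF intr_eq0 => /eqP.
- by exists v => //; rewrite numq_gt0 lt_neqAle eq_sym xv x_ge0.
Qed.

(* Adding E_y for y adjacent to, but outside of, the support of a cycle with chi = 0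
   does not increase chi, so in an elliptic graph chi stays 0. *)
Lemma grow_support S Y l : (forall l, nonneg_on S l -> 0 <= chi2 S l) -> Y \subset S ->
  nonneg_on Y l -> chi2 S l = 0 ->
  (forall A : {set V}, (forall v, 0 < l v -> v \in A) -> A \proper Y ->
     exists x y, [/\ x \in A, y \in Y, y \notin A & adj x y]) ->
  exists D, [/\ nonneg_on Y D, chi2 S D = 0 & forall v, v \in Y -> 0 < D v].
Proof.
move=> Sge0 YS lY chil exitY.
pose supp (a : V -> int) := [set v | 0 < a v].
suff main n : forall a, nonneg_on Y a -> chi2 S a = 0 ->
    (forall v, 0 < l v -> 0 < a v) -> (#|Y :\: supp a| <= n)%N ->
    exists D, [/\ nonneg_on Y D, chi2 S D = 0 & forall v, v \in Y -> 0 < D v].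
  exact: (main _ l lY chil _ (leqnn _)).
elim: n => [|n IH] a [a0 aY] chia la card_a.
  exists a; split=> // v vY; rewrite ltNge; apply/negP => av.
  move: card_a; rewrite leqn0 cards_eq0 => /eqP/setP/(_ v).
  by rewrite !inE vY ltNge av.
have suppY : supp a \subset Y.
  apply/subsetP => v; rewrite inE => av; apply: contraLR av => /aY ->.
  by rewrite ltxx.
have [Ysupp|/negP YNsupp] := boolP (Y \subset supp a).
  by exists a; split=> // v /(subsetP Ysupp); rewrite inE.
have [x [y []]] := exitY (supp a) (fun v lv => etrans (in_set _ _) (la v lv))
  (introT andP (conj suppY (introN idP YNsupp))).
rewrite !inE => ax yY ay xy.
have aSy : nonneg_on Y (addE a y) by apply: nonneg_addE.
have ay0 : a y = 0 by apply/eqP; rewrite eq_le a0 leNgt ay.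
have yS := subsetP YS _ yY.
have xS : x \in S by apply/(subsetP YS)/(subsetP suppY); rewrite inE.
apply: (IH (addE a y)) => //.
- apply/eqP; rewrite eq_le Sge0 ?andbT; last first.
    by split=> v; [apply: aSy.1 | move=> vS; apply: aSy.2; apply: contra vS => /(subsetP YS)].
  rewrite chi2_addE // chia.
  have : 0 < inter S a y by apply: (inter_gt0 a0 ay0 xS); rewrite // adjC.
  lia.
- by move=> v lv; rewrite /addE ltr_wpDr ?ler0n // la.
rewrite -ltnS; apply: leq_trans card_a; apply: proper_card; apply/properP; split.
  apply/subsetP => v; rewrite !inE -!leNgt => /andP[av ->]; rewrite andbT.
  by apply: le_trans av; rewrite lerDl ler0n.
by exists y; rewrite !inE yY /addE ?eqxx ay0.
Qed.

(** The rational solution multiplied by the product [D] of its denominators. *)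
Lemma negdef_solve_int S (f : V -> int) : negdef adj e S ->
  exists (D : int) l, [/\ 0 < D, forall v, v \notin S -> l v = 0 &
    forall w, w \in S -> inter S l w = D * f w].
Proof.
move=> nS; have [x [xS xE]] := negdef_solve adjC adjI (fun v => (f v)%:~R) nS.
pose D := \prod_v denq (x v).
pose l v := numq (x v) * \prod_(u | u != v) denq (x u).
have lE v : (l v)%:~R = D%:~R * x v.
  by rewrite /l /D [in RHS](bigD1 v) //= !intrM numqE; ring.
exists D, l; split=> [|v vS|w wS]; first by apply: prodr_gt0 => v _; apply: denq_gt0.
  by rewrite /l xS // [numq 0]/(0 : int) mul0r.
apply/eqP; rewrite -(eqr_int rat) -inter_intr rmorphM /= -xE //.
rewrite (@inter_lin _ _ e _ S D%:~R 0 x x); first by rewrite mul0r addr0.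
by move=> u; rewrite lE mul0r addr0.
Qed.

Lemma negdef_int_ge0 S l : negdef adj e S -> (forall v, v \notin S -> l v = 0) ->
  (forall w, w \in S -> inter S l w <= 0) -> nonneg_on S l.
Proof.
move=> nS lS ll; split=> // v; have [vS|/lS -> //] := boolP (v \in S).
rewrite -(ler0z rat).
apply: (@negdef_ge0 _ _ e adjC adjI S (fun u => (l u)%:~R) nS) => // w wS.
by rewrite inter_intr lerz0 ll.
Qed.

(* Laufer's computation sequence starting at E_u, bounded by M. *)
Lemma laufer S X u (M : V -> int) : u \in X -> X \subset S ->
  (forall a, nonneg_on X a -> 2 * a u <= chi2 S a) ->
  (forall v, 0 <= M v) -> (forall w, w \in X -> inter S M w < 0) ->
  exists a, [/\ nonneg_on X a, a u = 1 & forall w, w \in X -> inter S a w <= 0].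
Proof.
move=> uX XS chiX M0 MX.
have M1 : 0 < M u.
  rewrite lt_neqAle M0 andbT; apply/eqP => Mu.
  by have := inter_ge0 S M0 (esym Mu); rewrite leNgt MX.
suff main n : forall a, nonneg_on X a -> a u = 1 -> (forall v, a v <= M v) ->
    chi2 S a <= 2 -> \sum_v (M v - a v) < n%:Z ->
    exists a, [/\ nonneg_on X a, a u = 1 & forall w, w \in X -> inter S a w <= 0].
  pose a0 := addE (fun=> 0) u.
  have a0M v : a0 v <= M v.
    by rewrite /a0 /addE add0r; case: eqVneq => [->|_] //; rewrite -gtz0_ge1.
  apply: (main (absz (\sum_v (M v - a0 v))).+1 a0) => //.
  - by apply: nonneg_addE.
  - by rewrite /a0 /addE eqxx.
  - by rewrite chi2_E // (subsetP XS).
  - by rewrite -addn1 PoszD gez0_abs ?ltrDl // sumr_ge0 // => v _; rewrite subr_ge0.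
elim: n => [|n IH] a aX au aM chia sum_a.
  by move: sum_a; rewrite ltNge sumr_ge0 // => v _; rewrite subr_ge0.
have [/forallP aw|] := boolP [forall w in X, inter S a w <= 0].
  by exists a; split=> // w wX; apply: (implyP (aw w)).
rewrite negb_forall => /existsP[w]; rewrite negb_imply -ltNge => /andP[wX aw].
have wS := subsetP XS _ wX; have aXw := nonneg_addE aX wX.
have chiw : chi2 S (addE a w) <= 2 by rewrite chi2_addE //; lia.
(* A second E_u would give coefficient 2 at u with [chi2] at most 2, while the lower bound on X
   demands at least 4. *)
have uw : u != w.
  apply/eqP => uw; move: aXw chiw; rewrite -uw => /chiX.
  by rewrite {1}/addE eqxx au; lia.
(* If a_w = M_w, then M - a >= 0 vanishes at w and (M - a, E_w) >= 0, contradicting (M, E_w) < 0 <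
   (a, E_w). *)
have aMw : a w < M w.
  rewrite lt_neqAle aM andbT; apply/eqP => aMw.
  have MA v : 0 <= M v - a v by rewrite subr_ge0.
  have := inter_ge0 S MA; move=> /(_ w); rewrite aMw subrr => /(_ erefl).
  rewrite (@inter_lin _ _ e _ S 1 (-1) M a); last by move=> v; ring.
  by have := MX w wX; lia.
apply: (IH (addE a w)) => //.
- by rewrite /addE (negbTE uw) addr0.
- move=> v; rewrite /addE; case: eqVneq => [->|_]; last by rewrite addr0.
  by rewrite -ltzD1 ltrD2r.
have -> : \sum_v (M v - addE a w v) = \sum_v (M v - a v) - 1.
  rewrite /addE; under eq_bigr do rewrite opprD addrA.
  rewrite sumrB; congr (_ - _); rewrite (bigD1 w) //= eqxx big1 ?addr0 // => v.
  by move/negbTE->.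
by move: sum_a; lia.
Qed.

End EulerCharacteristic.

(** * Half lines of admissible coefficients on the branches outside T *)

Lemma antitone_threshold (h : int -> int) (m : int) :
  (forall x, h (x + 1) <= h x) -> 0 < m -> (forall x, h (x + m) < h x) ->
  exists z, forall x, (0 <= h x) = (x <= z).
Proof.
move=> h1 m0 hm.
have anti_nat x (n : nat) : h (x + n%:Z) <= h x.
  elim: n => [|n IH]; first by rewrite addr0.
  by apply: le_trans IH; rewrite -addn1 PoszD addrA.
have anti x y : x <= y -> h y <= h x.
  by move=> xy; rewrite -(subrK x y) addrC -[y - x]gez0_abs ?subr_ge0 // anti_nat.
(* By integrality a strict drop over m is a drop by at least 1, so n periods lower h by at least
   n. *)
have fast x (n : nat) : h (x + m * n%:Z) <= h x - n%:Z.
  elim: n => [|n IH]; first by rewrite mulr0 addr0 subr0.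
  have := hm (x + m * n%:Z).
  have -> : x + m * n%:Z + m = x + m * n.+1%:Z by rewrite -addn1 PoszD; ring.
  by lia.
have drop_neg (p q : int) : q <= p - (absz q)%:Z -> 0 <= p by lia.
have drop_pos (p q : int) : p <= q - (absz q).+1%:Z -> p < 0 by lia.
(* Going |h 0| periods to the left raises h to a nonnegative value; |h 0| + 1 periods to the right
   make it negative. *)
pose lo := - (m * (absz (h 0))%:Z).
have hlo : 0 <= h lo.
  by have := fast lo (absz (h 0)); rewrite /lo addNr => /drop_neg.
pose hi := m * (absz (h 0)).+1%:Z.
have hhi : h hi < 0.
  by rewrite /hi; have := fast 0 (absz (h 0)).+1; rewrite add0r => /drop_pos.
have exP : exists n : nat, 0 <= h (lo + n%:Z) by exists 0%N; rewrite addr0.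
have ubP (n : nat) : 0 <= h (lo + n%:Z) ->
    (n <= absz (hi - lo))%N.
  move=> hn; rewrite leqNgt; apply/negP => n_big.
  have /anti : hi <= lo + n%:Z.
    move: hi lo n_big {hlo hhi hn exP} => hi lo n_big.
    have : hi - lo <= (absz (hi - lo))%:Z by rewrite abszE ler_norm.
    by lia.
  by lia.
case: (ex_maxnP exP ubP) => n hn n_max; exists (lo + n%:Z) => x.
apply/idP/idP => [hx|/anti]; last exact: le_trans.
rewrite leNgt; apply/negP => x_big.
have xE : x = lo + (absz (x - lo))%:Z by rewrite gez0_abs; lia.
by have := n_max (absz (x - lo)); rewrite -xE => /(_ hx); lia.
Qed.

Section Branches.
Variables (V : finType) (adj : rel V) (e : V -> int).
Variables (S T : {set V}) (par : V -> V) (d : V -> nat).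
Hypothesis adjC : symmetric adj.
Hypothesis adjI : irreflexive adj.
Hypothesis ellS : elliptic adj e S.
Hypothesis ellT : elliptic adj e T.
Hypothesis TS : T \subset S.
Hypothesis pd : parent_fun adj S T par d.
Local Notation inter := (intersection_number adj e).
Local Notation valency := (valency adj).

Definition children (v : V) : {set V} := [set w in S :\: T | par w == v].

Lemma adj_branch v u : v \in S :\: T -> u \in S -> adj v u = (u == par v) || (u \in children v).
Proof.
move=> /setDP[vS vT] uS; have [pS pv dpv] := pd vS vT.
apply/idP/idP => [vu|/orP[/eqP -> //|]].
  have [[vT' _]|[_ ->]|[uT uE]] := tree_edges adjC ellS.1.1 ellT.1.1 TS pd vS uS vu.
  - by rewrite vT' in vT.
  - by rewrite eqxx.
  - by rewrite !inE uT uS uE eqxx orbT.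
by rewrite !inE => /andP[/andP[uT _] /eqP <-]; have [_ ? _] := pd uS uT; rewrite adjC.
Qed.

Lemma adj_core v u : v \in T -> u \in S -> adj v u = (u \in T) && adj v u || (u \in children v).
Proof.
move=> vT uS; have vS := subsetP TS _ vT.
apply/idP/idP => [vu|/orP[/andP[] //|]].
  have [[_ uT]|[vT' _]|[uT uE]] := tree_edges adjC ellS.1.1 ellT.1.1 TS pd vS uS vu.
  - by rewrite uT vu.
  - by rewrite vT in vT'.
  - by rewrite !inE uT uS uE eqxx orbT.
by rewrite !inE => /andP[/andP[uT _] /eqP <-]; have [_ ? _] := pd uS uT; rewrite adjC.
Qed.

Lemma par_notin_children v : v \in S :\: T -> par v \notin children v.
Proof.
move=> /setDP[vS vT]; have [pS _ dpv] := pd vS vT.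
rewrite !inE pS andbT; apply/negP => /andP[pT /eqP ppv].
by have [_ _] := pd pS pT; rewrite ppv => /(ltn_trans dpv); rewrite ltnn.
Qed.

Lemma childrenP v w : reflect [/\ w \in S :\: T, par w = v & (d v < d w)%N] (w \in children v).
Proof.
rewrite [X in reflect _ X]in_set; apply: (iffP andP) => [[wN /eqP pw]|[-> -> _]]; last by rewrite eqxx.
by split=> //; move/setDP: (wN) => [wS wT]; have [_ _] := pd wS wT; rewrite pw.
Qed.

Lemma children_sub v : children v \subset S.
Proof. by apply/subsetP => w /childrenP[/setDP[]]. Qed.

Lemma sum_branch (F : V -> int) v : v \in S :\: T ->
  \sum_(u in S | adj v u) F u = F (par v) + \sum_(w in children v) F w.
Proof.
move=> vN; have /setDP[vS vT] := vN; have [pS pv _] := pd vS vT.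
rewrite (bigD1 (par v)) ?pS //=; congr (_ + _); apply: eq_bigl => u.
have [uS|uS] := boolP (u \in S); last first.
  by symmetry; apply/negbTE; apply: contra uS; apply/subsetP/children_sub.
rewrite adj_branch //=; have [->|_] := eqVneq u (par v); last by rewrite andbT.
by rewrite andbF (negbTE (par_notin_children vN)).
Qed.

Lemma sum_core (F : V -> int) v : v \in T ->
  \sum_(u in S | adj v u) F u = \sum_(u in T | adj v u) F u + \sum_(w in children v) F w.
Proof.
move=> vT; rewrite (bigID [in T]) /=; congr (_ + _); apply: eq_bigl => u.
  by rewrite andbAC; have [/(subsetP TS)->|] := boolP (u \in T); rewrite ?andbF.
have [uS|uS] := boolP (u \in S); last first.
  by symmetry; apply/negbTE; apply: contra uS; apply/subsetP/children_sub.
rewrite adj_core //= andb_orl; have [uT|uT] := boolP (u \in T).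
  by rewrite !andbF; symmetry; apply/negbTE; rewrite !inE uT.
by rewrite /= andbT.
Qed.

Lemma valency_sum (A : {set V}) v : (valency A v)%:Z = \sum_(u in A | adj v u) 1.
Proof.
rewrite /Defs.valency -[LHS]natz -sumr_const; apply: eq_bigl => u; exact: in_set.
Qed.

Lemma inter_branch (l : V -> int) v : v \in S :\: T ->
  inter S l v = e v * l v + l (par v) + \sum_(w in children v) l w.
Proof. by move=> vN; rewrite /intersection_number sum_branch // intz addrA. Qed.

Lemma inter_core (l : V -> int) v : v \in T ->
  inter S l v = inter T l v + \sum_(w in children v) l w.
Proof. by move=> vT; rewrite /intersection_number sum_core // addrA. Qed.

Lemma valency_branch v : v \in S :\: T -> (valency S v)%:Z = #|children v|%:Z + 1.
Proof. by move=> vN; rewrite valency_sum sum_branch // sumr_const natz addrC. Qed.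

Lemma valency_core v : v \in T ->
  (valency S v)%:Z = (valency T v)%:Z + #|children v|%:Z.
Proof. by move=> vT; rewrite !valency_sum sum_core //; congr (_ + _); rewrite sumr_const natz. Qed.

(** Takes all ranks from [d u] on rather than only the branch of u: the rest of S is then T together
    with lower ranks, and a parent of one of its vertices outside T stays in it. *)
Definition below (u : V) : {set V} := [set w in S :\: T | (d u <= d w)%N].

(* For a cycle D with chi(D) = 0 which is positive off the set [below u]:
   0 <= chi(D + l) = chi(l) - (D, l) and (D, l) >= D_{par u} l_u. *)
Lemma chi2_below u (l : V -> int) : u \in S :\: T -> nonneg_on (below u) l ->
  2 * l u <= chi2 adj e S l.
Proof.
move=> uN [l0 lX]; have /setDP[uS uT] := uN; have [pS pu dpu] := pd uS uT.
(* A cycle of T with chi = 0 is spread first over T, by connectedness, and then over Y, where a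
   missing vertex of least rank has its parent already present. *)
have [D0 [D0T chiD0 [t tT D0t]]] := elliptic_cycle adjC adjI ellT.
have chiS0 a : nonneg_on S a -> 0 <= chi2 adj e S a.
  exact: elliptic_chi2_ge0.
have [D1 [D1T chiD1 D1pos]] : exists D,
    [/\ nonneg_on T D, chi2 adj e S D = 0 & forall v, v \in T -> 0 < D v].
  apply: (grow_support adjC adjI chiS0 TS D0T); first by rewrite (@chi2_subset _ adj e S T) //; case: D0T.
  move=> A D0A AT; have /properP[_ [v vT vA]] := AT.
  have [x [y [xA yT yA xy]]] := connected_exit ellT.1.1.1 (proper_sub AT) (D0A _ D0t) vT vA.
  by exists x, y.
pose Y := S :\: below u.
have TY : T \subset Y.
  by apply/subsetP => v vT; rewrite !inE vT (subsetP TS).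
have [D [[D_ge0 DY] chiD Dpos]] : exists D,
    [/\ nonneg_on Y D, chi2 adj e S D = 0 & forall v, v \in Y -> 0 < D v].
  apply: (@grow_support _ adj e adjC adjI S Y D1 chiS0) => //; first exact: subsetDl.
    split; first by case: D1T.
    by move=> v vY; apply: D1T.2; apply: contra vY; apply/subsetP.
  move=> A D1A /properP[AY [v0 v0Y v0A]].
  case: (arg_minnP d (introT andP (conj v0Y v0A) : [pred v | (v \in Y) && (v \notin A)] v0)).
  move=> y /andP[yY yA] y_min; have /setDP[yS yX] := yY.
  have yT : y \notin T by apply: contra yA => yT; apply/D1A/D1pos.
  have [pyS py dpy] := pd yS yT; exists (par y), y; rewrite adjC; split=> //.
  apply/negPn/negP => pA; have pY : par y \in Y.
    apply/setDP; split=> //; apply: contra yX; rewrite ![_ \in below u]in_set.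
    case/andP=> _ du; rewrite in_setD yS yT /=; exact: leq_trans du (ltnW dpy).
  by have := y_min (par y); rewrite /= pY pA => /(_ isT); rewrite leqNgt dpy.
have SDl : nonneg_on S (fun v => D v + l v).
  split=> v; first by rewrite addr_ge0.
  by move=> vS; rewrite DY ?lX ?addr0 // !inE (negbTE vS) !andbF.
have := chiS0 _ SDl; rewrite (@chi2D _ adj e adjC S D l) // chiD add0r.
have D0X v : v \in below u -> D v = 0 by move=> vX; apply: DY; rewrite in_setD vX.
suff lu : l u <= \sum_(v in S) l v * inter S D v.
  by lia.
have uX : u \in below u by rewrite inE uN leqnn.
rewrite (bigD1 u) //=; apply: ler_wpDr.
  apply: sumr_ge0 => v _; have [vX|vX] := boolP (v \in below u); last by rewrite lX // mul0r.
  by rewrite mulr_ge0 // inter_ge0 // D0X.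
rewrite ler_peMr // -gtz0_ge1; apply: (inter_gt0 e D_ge0 (D0X _ uX) pS pu).
by apply: Dpos; rewrite !inE pS (leqNgt (d u)) dpu !andbF.
Qed.

(** A multiple of the solution of (M, E_w) = -1 on S \ T. It bounds Laufer's sequences and later
    supplies the strict drop that makes the thresholds finite. *)
Lemma antinef_branches : exists M : V -> int, nonneg_on (S :\: T) M /\
  forall w, w \in S :\: T -> inter S M w < 0.
Proof.
have nN := negdef_sub adjC adjI (subsetDl S T) ellS.1.2.
have [D [M [D0 M0 ME]]] := negdef_solve_int adjC adjI (fun=> -1) nN.
have MN w : w \in S :\: T -> inter (S :\: T) M w < 0.
  by move=> wN; rewrite ME // mulrN1 oppr_lt0.
exists M; split=> [|w wN].
  by apply: (negdef_int_ge0 adjC adjI nN M0) => w /MN/ltW.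
by rewrite (@inter_subset _ adj e _ S (S :\: T)) ?subsetDl ?MN // => u _; apply: M0.
Qed.

(** Adding this cycle to l raises l_u by exactly one and increases no (l, E_w) on [below u]. *)
Lemma unit_antinef u : u \in S :\: T ->
  exists a, [/\ nonneg_on (below u) a, a u = 1 & forall w, w \in below u -> inter S a w <= 0].
Proof.
move=> uN; have [M [[M0 _] MN]] := antinef_branches.
apply: (@laufer _ adj e adjC adjI S (below u) u M) => //.
- by rewrite inE uN leqnn.
- by apply/subsetP => w; rewrite inE => /andP[/setDP[]].
- by move=> a aX; apply: chi2_below.
- by move=> w; rewrite inE => /andP[/MN].
Qed.

(* [g v a] is the largest coefficient at v of an extension over the branch of v
   of a vector with coefficient a at the parent of v, subject to
   (l, E_w) + delta_w - 2 >= 0 on the branch. *)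
Definition bound_spec (g : V -> int -> int) (v : V) := forall a x,
  (0 <= a + (e v * x + \sum_(w in children v) g w x + #|children v|%:Z - 1)) = (x <= g v a).

(** Subtracting from an admissible extension a cycle that is anti-nef from rank [d v] on keeps it
    admissible. The induction needs this at the children of a vertex to see that the admissible
    values there form a half line. *)
Definition bound_shift (g : V -> int -> int) (v : V) := forall l : V -> int,
  (forall w, w \in S :\: T -> (d v <= d w)%N -> inter S l w <= 0) ->
  forall a, g v (a + l (par v)) <= g v a + l v.

(** Downward induction on the rank: stage m treats the vertices with N < d v + m, whose children
    belong to the previous stage. *)
Lemma exists_bound : exists g, forall v, v \in S :\: T -> bound_spec g v.
Proof.
pose N := (\sum_v d v)%N.
suff main m : exists g, forall v, v \in S :\: T -> (N < d v + m)%N ->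
    bound_spec g v /\ bound_shift g v.
  have [g gP] := main N.+1; exists g => v vN.
  by have [] := gP v vN _ => //; rewrite addnS ltnS leq_addl.
elim: m => [|m [g gP]].
  by exists (fun _ _ => 0) => v _; rewrite addn0 ltnNge /N (bigD1 v) //= leq_addr.
pose h v x := e v * x + \sum_(w in children v) g w x + #|children v|%:Z - 1.
have hstep v (l : V -> int) x : v \in S :\: T -> (N < d v + m.+1)%N ->
    (forall w, w \in S :\: T -> (d v <= d w)%N -> inter S l w <= 0) ->
    h v (x + l v) <= h v x + (inter S l v - l (par v)).
  move=> vN dv lle; rewrite inter_branch // /h.
  have : \sum_(w in children v) g w (x + l v) <=
      \sum_(w in children v) g w x + \sum_(w in children v) l w.
    rewrite -big_split /=; apply: ler_sum => w /childrenP[wN pw dvw].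
    have [|_ shift_w] := gP w wN; first by move: dv; rewrite addnS ltnS; lia.
    rewrite -{1}pw; apply: shift_w => u uN dwu.
    by apply: lle => //; apply: leq_trans dwu; apply: ltnW.
  by lia.
have [M [[M0 MN0] MN]] := antinef_branches.
have thr (p : V * int) : exists z, p.1 \in S :\: T -> (N < d p.1 + m.+1)%N ->
    forall x, (0 <= p.2 + h p.1 x) = (x <= z).
  case: p => v a /=; have [vN|_] := boolP (v \in S :\: T); last by exists 0.
  have [dv|_] := boolP (N < d v + m.+1)%N; last by exists 0.
  have /setDP[vS vT] := vN; have [pS pv dpv] := pd vS vT.
  have [b [[b0 bX] bv ble]] := unit_antinef vN.
  have [z zP] : exists z, forall x, (0 <= a + h v x) = (x <= z).
    (* The cycle [b], with coefficient 1 at v and 0 at [par v], gives monotonicity; the strictly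
       anti-nef [M] gives the strict drop over M_v. *)
    apply: (@antitone_threshold (fun x => a + h v x) (M v)) => [x||x].
    - rewrite lerD2l; have := @hstep v b x vN dv; rewrite bv => hb.
      have /hb : forall w, w \in S :\: T -> (d v <= d w)%N -> inter S b w <= 0.
        by move=> w wN dvw; apply: ble; rewrite in_set wN.
      move/le_trans; apply; rewrite gerDl bX ?subr0; first by apply: ble; rewrite in_set vN /=.
      by rewrite in_set negb_and -ltnNge dpv orbT.
    - rewrite lt_neqAle M0 andbT; apply/eqP => Mv.
      by have := inter_ge0 adj e S M0 (esym Mv); rewrite leNgt MN.
    - rewrite ltrD2l; apply: (le_lt_trans (hstep v M x vN dv _)).
        by move=> w wN _; apply/ltW/MN.
      by rewrite gtrDl; have := MN v vN; have := M0 (par v); lia.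
  by exists z.
have [z zP] := boolp.choice thr.
pose g' v a := if (N < d v + m)%N then g v a else z (v, a).
have g'E v w x : (N < d v + m.+1)%N -> w \in children v -> g' w x = g w x.
  by move=> dv /childrenP[_ _ dvw]; rewrite /g'; case: ifP => //; move: dv; rewrite addnS ltnS; lia.
have spec v : v \in S :\: T -> (N < d v + m.+1)%N ->
    forall a x, (0 <= a + h v x) = (x <= g' v a).
  move=> vN dv a x; rewrite /g'; case: ifP => [dv'|_]; first exact: (gP v vN dv').1.
  exact: (zP (v, a) vN dv x).
exists g' => v vN dv; split=> [a x|l lle a].
  rewrite -spec // /h; congr (0 <= a + (_ + _ + _ - _)).
  by apply: eq_bigr => w wv; rewrite (g'E v).
(* It suffices that the extremal value for a + l_{par v}, lowered by l_v, is admissible for a;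
   [hstep] at that point shows it. *)
rewrite -lerBlDr -spec //.
have := spec v vN dv (a + l (par v)) (g' v (a + l (par v))); rewrite lexx.
have := hstep v l (g' v (a + l (par v)) - l v) vN dv lle; rewrite subrK.
have : inter S l v <= 0 by apply: lle.
move: (h v _) (h v _) => p q; lia.
Qed.

End Branches.

(** * Coefficients of (1 - s)^n and their partial sums *)

Section TaylorCoefficients.

Lemma taylorz_neg1 k : taylorz (-1) k = (0 <= k)%R%:R.
Proof. by case: k => // k; rewrite /taylorz /taylorc /= addn1 subn1 /= binn. Qed.

Lemma taylorz_step n k : taylorz n k - taylorz n (k - 1) = taylorz (n + 1) k.
Proof.
case: k => [[|k]|k]; last by rewrite (_ : Negz k - 1 = Negz k.+1) ?subr0 // !NegzE; lia.
  by rewrite sub0r /taylorz /taylorc /= !bin0; case: ifP; case: ifP.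
have -> : k.+1%:Z - 1 = k by lia.
rewrite /taylorz; case: n => [n|[|n]].
- have -> : n%:Z + 1 = n.+1%:Z by lia.
  by rewrite /taylorc /= binS exprS PoszD !mulN1r !mulNr mulrDr opprD.
- have -> : Negz 0 + 1 = 0 by [].
  by rewrite /taylorc /= !addnK !binn bin0n mulr0.
have -> : Negz n.+1 + 1 = Negz n by rewrite !NegzE; lia.
rewrite /taylorc /=.
have -> : (k.+1 + n.+2 - 1 = (k + n.+1).+1)%N by lia.
have -> : (k + n.+2 - 1 = k + n.+1)%N by lia.
have -> : (k.+1 + n.+1 - 1 = k + n.+1)%N by lia.
by rewrite binS PoszD addrK.
Qed.

Lemma sum_taylorz_nat n k m :
  \sum_(t < m) taylorz (n + 1) (k - t%:Z) = taylorz n k - taylorz n (k - m%:Z).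
Proof.
elim: m => [|m IH]; first by rewrite big_ord0 subr0 subrr.
rewrite big_ord_recr /= IH -taylorz_step -[in RHS]addn1 PoszD opprD addrA.
by rewrite addrA subrK.
Qed.

(* Summing over y <= g multiplies the generating function by 1/(1-s). *)
Lemma sum_taylorz n k g :
  \sum_(y \in [set: int]) (y <= g)%R%:R * taylorz (n + 1) (k + y) = taylorz n (k + g).
Proof.
pose m := (absz (k + g)).+1; pose h (t : nat) : int := g - t%:Z.
rewrite -(@fsbig_widen _ _ _ _ (h @` `I_m)%classic) //; last first.
  move=> y [_ hy]; rewrite /preimage /=; have [yg|] := boolP (y <= g); last by rewrite mul0r.
  have : k + y < 0.
    rewrite ltNge; apply/negP => ky; apply: hy; exists (absz (g - y)); rewrite /= /m /h.
      by move: yg ky; lia.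
    by rewrite gez0_abs ?subr_ge0 //; lia.
  by case: (k + y) => // ? _; rewrite mulr0.
rewrite fsbig_image; last by move=> a b _ _ /=; rewrite /h; lia.
rewrite -fsbig_ord.
have tail : taylorz n (k + g - m%:Z) = 0.
  have : k + g - m%:Z < 0 by rewrite /m; lia.
  by case: (k + g - _).
transitivity (taylorz n (k + g) - taylorz n (k + g - m%:Z)); last by rewrite tail subr0.
rewrite -sum_taylorz_nat; apply: eq_bigr => t _.
by rewrite /h gerBl lez_nat leq0n mul1r addrA.
Qed.

End TaylorCoefficients.

Lemma fsum_fiber (R : nmodType) (I J : choiceType) (A : set I) (Q : set J) (p : I -> J)
    (F : I -> R) :
  (forall i, A i -> Q (p i)) -> finite_set (A `&` [set i | F i <> 0])%classic ->
  \sum_(i \in A) F i = \sum_(j \in Q) \sum_(i \in A `&` [set i | p i = j]) F i.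
Proof.
move=> pQ finA; set A' := (_ `&` _)%classic in finA.
pose Q' := (p @` A')%classic.
have finQ : finite_set Q' by apply: finite_image.
have sumA (C : set I) : \sum_(i \in A `&` C) F i = \sum_(i \in A' `&` C) F i.
  symmetry; apply: fsbig_widen; first by move=> i [[]].
  by move=> i [[Ai Ci] /not_andP[/not_andP[]|]] //= /contrapT.
have -> : \sum_(i \in A) F i = \sum_(i \in A') F i.
  by have := sumA classical_sets.setT; rewrite !classical_sets.setIT.
transitivity (\sum_(j \in Q') \sum_(i \in A') (if p i == j then F i else 0)).
  rewrite exchange_fsbig //; apply: eq_fsbigr => i /set_mem A'i.
  rewrite -(fsbig_widen [set p i]%classic) ?fsbig_set1 ?eqxx //.
    by move=> _ ->; exists i.
  by move=> j [_ /= pj]; rewrite /preimage /=; case: eqVneq => // /esym.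
rewrite -(fsbig_widen Q' Q); last 2 first.
- by move=> _ [i [Ai _] <-]; apply: pQ.
- move=> j [_ jQ']; rewrite /preimage /= sumA fsbig1 // => i [A'i /= pij].
  by case: jQ'; exists i.
apply: eq_fsbigr => j _; rewrite sumA.
transitivity (\sum_(i \in A' `&` [set i | p i = j]) (if p i == j then F i else 0)).
  symmetry; apply: fsbig_widen => i; first by case.
  by move=> [A'i /not_andP[//|pij]]; rewrite /preimage /=; case: eqVneq.
by apply: eq_fsbigr => i /set_mem[_ /= ->]; rewrite eqxx.
Qed.

Section Finiteness.
Variables (V : finType) (adj : rel V) (e : V -> int).
Implicit Types S : {set V}.
Hypothesis adjC : symmetric adj.
Hypothesis adjI : irreflexive adj.
Local Notation inter := (intersection_number adj e).

(* With M = D E_{v0}^*, all coordinates of M are positive and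
   sum_w M_w (l, E_w) = - D l_{v0} is determined by c. *)
Lemma finite_coord_fiber S v0 (c : int) : negdef adj e S -> connectedG adj S -> v0 \in S ->
  finite_set [set l : vecZ V | [/\ forall v, v \notin S -> l v = 0, l v0 = c &
    forall v, v \in S -> 0 <= expo adj e S l v]]%classic.
Proof.
move=> nS cS v0S; set A := mkset _.
have [D [M [D0 M0 ME]]] := negdef_solve_int adjC adjI (fun v => - (v == v0)%:R) nS.
have Mpos w : w \in S -> 0 < M w.
  move=> wS; rewrite -(ltr0z rat).
  apply: (@negdef_gt0 _ _ e adjC adjI S (fun u => (M u)%:~R) nS cS) => // [v vS|].
    by rewrite inter_intr lerz0 ME // mulrN oppr_le0 mulr_ge0 ?ler0n // ltW.
  by exists v0; rewrite // inter_intr ltrz0 ME // eqxx mulrN1 oppr_lt0.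
pose C := \sum_(v in S) M v * ((valency adj S v)%:Z - 2) - D * c.
have expo_sum l : A l -> \sum_(v in S) M v * expo adj e S l v = C.
  move=> [lS lv0 _]; rewrite /C -[- (D * c)]mulrN addrC.
  have -> : D * - c = \sum_(v in S) M v * inter S l v.
    rewrite (inter_sym e adjC) (bigD1 v0) //= ME // eqxx lv0 big1 ?addr0 /=; first by ring.
    by move=> v /andP[vS /negbTE vv0]; rewrite ME // vv0 oppr0 !mulr0.
  by rewrite -big_split /=; apply: eq_bigr => v _; rewrite /expo; ring.
have expo_le l v : A l -> v \in S -> expo adj e S l v <= C.
  move=> Al vS; have [_ _ l0] := Al; rewrite -(expo_sum l Al) (bigD1 v) //=.
  apply: ler_wpDr; last by rewrite ler_peMl ?l0 // -gtz0_ge1 Mpos.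
  by apply: sumr_ge0 => u /andP[uS _]; rewrite mulr_ge0 ?l0 // ltW ?Mpos.
pose f (l : vecZ V) : {ffun V -> 'I_(absz C).+1} := [ffun v => inord (absz (expo adj e S l v))].
have f_inj : {in A &, injective f}.
  move=> l1 l2 /set_mem A1 /set_mem A2 /ffunP f12.
  have ex12 v : v \in S -> expo adj e S l1 v = expo adj e S l2 v.
    move=> vS; have := f12 v; rewrite !ffunE => /(congr1 (@nat_of_ord _)).
    have [_ _ /(_ v vS) p1] := A1; have [_ _ /(_ v vS) p2] := A2.
    have q1 := expo_le _ _ A1 vS; have q2 := expo_le _ _ A2 vS.
    by rewrite !inordK; lia.
  apply/ffunP => v; have [vS|vS] := boolP (v \in S); last first.
    by have [/(_ v vS) -> _ _] := A1; have [/(_ v vS) -> _ _] := A2.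
  apply/eqP; rewrite -(eqr_int rat) -subr_eq0; apply/eqP.
  apply: (@negdef_inter0 _ _ e adjC adjI S (fun u => (l1 u)%:~R - (l2 u)%:~R) nS _ v vS) => w wS.
  rewrite (@inter_lin _ _ e _ S 1 (-1) (fun u => (l1 u)%:~R) (fun u => (l2 u)%:~R)); last first.
    by move=> u; ring.
  have := ex12 w wS; rewrite /expo => /addIr/addIr; rewrite !inter_intr => ->.
  by rewrite mul1r mulN1r subrr.
rewrite -(eq_finite_set (inj_card_eq f_inj)); exact: finite_finset.
Qed.

End Finiteness.

Section Elimination.
Variables (V : finType) (adj : rel V) (e : V -> int).
Variables (S T : {set V}) (par : V -> V) (d : V -> nat).
Hypothesis adjC : symmetric adj.
Hypothesis adjI : irreflexive adj.
Hypothesis ellS : elliptic adj e S.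
Hypothesis ellT : elliptic adj e T.
Hypothesis TS : T \subset S.
Hypothesis pd : parent_fun adj S T par d.
Variable g : V -> int -> int.
Hypothesis gP : forall v, v \in S :\: T -> bound_spec e S T par g v.
Local Notation inter := (intersection_number adj e).
Local Notation valency := (valency adj).
Local Notation children := (children S T par).
Local Notation expo := (expo adj e).

(* The weight left after summing over the coordinates outside of B. *)
Definition partial_factor (B : {set V}) (l : V -> int) (v : V) : int :=
  taylorz ((valency S v)%:Z - 2 - #|children v :\: B|%:Z)
    (expo S l v + \sum_(w in children v :\: B) g w (l v)).

Definition partial_weight (B : {set V}) (l : V -> int) : int :=
  \prod_(v in B) partial_factor B l v.

Variable l' : V -> int.

Definition extensions (B : {set V}) : set (vecZ V) :=
  [set l | (forall v, v \in T -> l v = l' v) /\ (forall v, v \notin B -> l v = 0)]%classic.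

Definition set_coord (l : vecZ V) (v : V) (y : int) : vecZ V :=
  [ffun u => if u == v then y else l u].

Lemma inter_set_coord (l : vecZ V) v y u : u != v -> v \in S -> l v = 0 ->
  inter S (set_coord l v y) u = inter S l u + (if adj u v then y else 0).
Proof.
move=> uv vS lv; rewrite /intersection_number ffunE (negbTE uv) -addrA; congr (_ + _).
have eq_out : \sum_(w in S | adj u w && (w != v)) set_coord l v y w =
    \sum_(w in S | adj u w && (w != v)) l w.
  by apply: eq_bigr => w /and3P[_ _ /negbTE wv]; rewrite ffunE wv.
case: ifP => a_uv.
  rewrite (bigD1 v) ?vS //= [in RHS](bigD1 v) ?vS //= ffunE eqxx lv add0r.
  under eq_bigl do rewrite -andbA; under [in RHS]eq_bigl do rewrite -andbA.
  by rewrite eq_out addrC.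
rewrite addr0; apply: eq_bigr => w /andP[_ uw]; rewrite ffunE.
by case: eqVneq uw => // ->; rewrite a_uv.
Qed.

Lemma partial_weight_step (B : {set V}) v (l : vecZ V) :
  v \in B -> B \subset S -> v \notin T -> par v \in B ->
  (forall w, w \in children v -> w \notin B) -> extensions (B :\ v) l ->
  \sum_(y \in [set: int]%classic) partial_weight B (set_coord l v y) =
    partial_weight (B :\ v) l.
Proof.
move=> vB BS vT pB chB [_ lB]; have vS := subsetP BS _ vB.
have vN : v \in S :\: T by rewrite inE vT.
have [pS pv dpv] := pd vS vT.
have pneqv : par v != v by apply: contraTneq dpv => ->; rewrite ltnn.
have l0 u : u \notin B -> l u = 0 by move=> uB; apply: lB; rewrite !inE (negbTE uB) andbF.
have lv0 : l v = 0 by apply: lB; rewrite !inE eqxx.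
have fv y : partial_factor B (set_coord l v y) v = (y <= g v (l (par v)))%R%:R.
  rewrite /partial_factor; have -> : children v :\: B = children v.
    by apply/setP => w; rewrite in_setD; case: (boolP (w \in children v)) => [/chB ->|]; rewrite ?andbF.
  have vval := valency_branch adjC ellS ellT TS pd vN.
  rewrite -(gP vN) -taylorz_neg1 /expo vval; congr taylorz; first by ring.
  rewrite (inter_branch adjC ellS ellT TS pd) // !ffunE eqxx (negbTE pneqv) big1.
    by ring.
  move=> w wv; rewrite ffunE l0 ?chB //; case: eqVneq => // wE.
  by move: wv (chB _ wv); rewrite wE vB.
have dv_sub : children (par v) :\: (B :\ v) = v |: (children (par v) :\: B).
  apply/setP => w; rewrite [LHS]in_setD in_setD1 in_setU1 in_setD negb_and negbK.
  by case: eqVneq => [->|//]; rewrite [_ \in children _]in_set vN eqxx.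
have v_notin : v \notin children (par v) :\: B by rewrite in_setD vB.
pose n := (valency S (par v))%:Z - 2 - #|children (par v) :\: (B :\ v)|%:Z.
pose k := expo S l (par v) + \sum_(w in children (par v) :\: B) g w (l (par v)).
have fp y : partial_factor B (set_coord l v y) (par v) = taylorz (n + 1) (k + y).
  rewrite /partial_factor /n dv_sub cardsU1 v_notin add1n intS; congr taylorz; first by ring.
  by rewrite /k /expo inter_set_coord // adjC pv ffunE (negbTE pneqv); ring.
have fp' : partial_factor (B :\ v) l (par v) = taylorz n (k + g v (l (par v))).
  rewrite /partial_factor -/n; congr taylorz.
  by rewrite dv_sub big_setU1 //= /k; ring.
have pBv : par v \in B :\ v by rewrite !inE pneqv.
pose R := \prod_(u in B :\ v | u != par v) partial_factor (B :\ v) l u.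
have split_w y : partial_weight B (set_coord l v y) =
    R * ((y <= g v (l (par v)))%R%:R * taylorz (n + 1) (k + y)).
  rewrite /partial_weight (big_setD1 v) //= fv (bigD1 (par v)) //= fp.
  rewrite (eq_bigr (partial_factor (B :\ v) l)); first by rewrite -/R; ring.
  move=> u /andP[/setD1P[uv uB] up]; have uS := subsetP BS _ uB.
  have uv_adj : adj u v = false.
    rewrite adjC (adj_branch adjC ellS ellT TS pd vN uS) (negbTE up) /=.
    by apply/negP => /chB; rewrite uB.
  rewrite /partial_factor /expo inter_set_coord // uv_adj addr0 ffunE (negbTE uv).
  have -> // : children u :\: (B :\ v) = children u :\: B.
  apply/setP => w; rewrite [LHS]in_setD [RHS]in_setD in_setD1 negb_and negbK.
  case: eqVneq => [->|//]; rewrite vB /=; apply/negbTE.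
  by rewrite [_ \in children _]in_set negb_and eq_sym up orbT.
under eq_fsbigr do rewrite split_w.
rewrite -mulr_fsumr sum_taylorz /partial_weight [RHS](bigD1 (par v)) //= fp' mulrC //.
Qed.

Lemma sum_extensions_step (B : {set V}) v :
  v \in B -> T \subset B -> B \subset S -> v \notin T -> par v \in B ->
  (forall w, w \in children v -> w \notin B) ->
  finite_set (extensions B `&` [set l | partial_weight B l <> 0])%classic ->
  finite_set (extensions (B :\ v) `&` [set l | partial_weight (B :\ v) l <> 0])%classic /\
  \sum_(l \in extensions B) partial_weight B l =
    \sum_(l \in extensions (B :\ v)) partial_weight (B :\ v) l.
Proof.
move=> vB TB BS vT pB chB finB.
have clear_ext (l : vecZ V) : extensions B l -> extensions (B :\ v) (set_coord l v 0).
  move=> [lT lB]; split=> u uH; rewrite ffunE.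
    by case: eqVneq => [uv|_]; [rewrite -uv uH in vT | apply: lT].
  by case: eqVneq uH => // uv; rewrite !inE uv /=; apply: lB.
have set_ext (l : vecZ V) y : extensions (B :\ v) l -> extensions B (set_coord l v y).
  move=> [lT lB]; split=> u uH; rewrite ffunE.
    by case: eqVneq => [uv|_]; [rewrite -uv uH in vT | apply: lT].
  by case: eqVneq uH => [->|uv uB]; [rewrite vB | apply: lB; rewrite !inE (negbTE uB) andbF].
have set_set (l : vecZ V) x y : set_coord (set_coord l v x) v y = set_coord l v y.
  by apply/ffunP => u; rewrite !ffunE; case: (u == v).
have set_id (l : vecZ V) : set_coord l v (l v) = l.
  by apply/ffunP => u; rewrite !ffunE; case: eqVneq => // ->.
have ext0 (l : vecZ V) : extensions (B :\ v) l -> set_coord l v 0 = l.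
  by move=> [_ lB]; rewrite -{2}(set_id l) lB // !inE eqxx.
split.
  apply: (sub_finite_set _ (finite_image (fun l => set_coord l v 0) finB)).
  move=> l [l_ext /= wl].
  have [y wy] : exists y, partial_weight B (set_coord l v y) <> 0.
    apply: contrapT => /forallNP w0; apply: wl.
    rewrite -partial_weight_step // fsbig1 // => y _.
    exact: contrapT (w0 y).
  by exists (set_coord l v y); [split=> //; apply: set_ext | rewrite set_set ext0].
rewrite (@fsum_fiber _ _ _ _ _ (fun l => set_coord l v 0) _ clear_ext finB).
apply: eq_fsbigr => l /set_mem l_ext.
rewrite -partial_weight_step // (@reindex_fsbig _ _ _ _ _ (set_coord l v) [set: int]%classic) //.
split.
- by move=> y _; split; [apply: set_ext | rewrite /= set_set ext0].
- by move=> y z _ _ /ffunP/(_ v); rewrite !ffunE eqxx.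
- by move=> a [a_ext /= <-]; exists (a v) => //; rewrite set_set set_id.
Qed.

Lemma sum_extensions (l0 : vecZ V) : (forall v, l0 v = l' v) -> (forall v, v \notin T -> l0 v = 0) ->
  finite_set (extensions S `&` [set l | partial_weight S l <> 0])%classic ->
  \sum_(l \in extensions S) partial_weight S l = partial_weight T l0.
Proof.
move=> l0E l0T finS.
suff main n : forall B : {set V}, T \subset B -> B \subset S -> #|B :\: T| = n ->
    (forall v, v \in B -> v \notin T -> par v \in B) ->
    finite_set (extensions B `&` [set l | partial_weight B l <> 0])%classic ->
    \sum_(l \in extensions B) partial_weight B l = partial_weight T l0.
  by apply: (main _ S) => // v vS vT; have [] := pd vS vT.
elim: n => [|n IH] B TB BS cardB parB finB.
  have -> : B = T.
    apply/eqP; rewrite eqEsubset TB andbT -setD_eq0 -cards_eq0 cardB //.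
  have -> : extensions T = [set l0]%classic; last by rewrite fsbig_set1.
  apply/seteqP; split=> l /= => [[lT lnT]|->]; last by split=> // v _; rewrite l0E.
  apply/ffunP => v; have [vT|vT] := boolP (v \in T); first by rewrite lT // l0E.
  by rewrite lnT // l0T.
have [v0 v0B] : exists v, v \in B :\: T by apply/card_gt0P; rewrite cardB.
case: (arg_maxnP d v0B) => v vBT v_max; have /setDP[vB vT] := vBT.
have chB w : w \in children v -> w \notin B.
  move=> /(childrenP pd)[/setDP[wS wT] _ dvw]; apply/negP => wB.
  have /v_max : w \in B :\: T by rewrite inE wT.
  by rewrite /= leqNgt dvw.
have pB := parB v vB vT.
have [finB' ->] := sum_extensions_step vB TB BS vT pB chB finB.
apply: IH finB'.
- by apply/subsetP => u uT; rewrite !inE (subsetP TB) // andbT; apply: contraNneq vT => <-.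
- exact: subset_trans (subsetDl _ _) BS.
- apply/eqP; rewrite -eqSS -cardB (cardsD1 v (B :\: T)) in_setD vT vB add1n eqSS; apply/eqP.
  by apply: eq_card => u; rewrite !inE andbCA.
move=> u /setD1P[uv uB] uT; rewrite !inE parB // andbT.
have uS := subsetP BS _ uB; apply: contraTneq uB => pu; apply: chB.
by rewrite [_ \in children _]in_set inE uT uS pu eqxx.
Qed.

Lemma coord_le_bound (l : V -> int) v : (forall v, v \in S -> 0 <= expo S l v) ->
  v \in S :\: T -> l v <= g v (l (par v)).
Proof.
move=> l_ge0.
have [n] := ubnP (\sum_u d u - d v)%N; elim: n v => // n IH v dv vN.
have /setDP[vS vT] := vN.
rewrite -(gP vN); apply: le_trans (l_ge0 v vS) _.
rewrite /expo (inter_branch adjC ellS ellT TS pd) // (valency_branch adjC ellS ellT TS pd) //.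
have : \sum_(w in children v) l w <= \sum_(w in children v) g w (l v).
  apply: ler_sum => w /(childrenP pd)[wN pw dvw]; rewrite -pw; apply: IH wN.
  rewrite ltnS in dv; apply: leq_trans dv; apply: ltn_sub2l => //.
  by rewrite (leq_trans dvw) // (bigD1 w) //= leq_addr.
by lia.
Qed.

Lemma partial_weight_full (l : vecZ V) : partial_weight S l = wcoef adj e S l.
Proof.
rewrite wcoefE //; last by case: ellS.1.
apply: eq_bigr => v vS; rewrite /partial_factor.
have -> : children v :\: S = finset.set0 by apply/eqP; rewrite setD_eq0 (children_sub pd).
by rewrite cards0 subr0 big_set0 addr0.
Qed.

Lemma partial_weight_core (l0 l : vecZ V) : wcoef adj e T l0 != 0 ->
  (forall v, v \notin T -> l0 v = 0) ->
  (forall v, v \in boundary adj S T -> valency T v = 1%N) ->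
  (forall v, v \in S -> 0 <= expo S l v) -> (forall v, v \in T -> l v = l0 v) ->
  partial_weight T l0 = wcoef adj e T l0.
Proof.
move=> wl0 l0T endT l_ge0 lE.
have nT : negdef adj e T by case: ellT.1.
rewrite wcoefE //; apply: eq_bigr => v vT; rewrite /partial_factor.
have vS := subsetP TS _ vT.
have -> : children v :\: T = children v.
  apply/setP => w; rewrite in_setD andbC; case: (boolP (w \in children v)) => //.
  by case/(childrenP pd)=> /setDP[_ ->].
rewrite (valency_core adjC ellS ellT TS pd vT).
have expoE (a : V -> int) : expo S a v =
    expo T a v + #|children v|%:Z + \sum_(w in children v) a w.
  by rewrite /expo (inter_core adjC ellS ellT TS pd) // (valency_core adjC ellS ellT TS pd) //; ring.
have sum0 : \sum_(w in children v) l0 w = 0.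
  by rewrite big1 // => w /(childrenP pd)[/setDP[_ /l0T]].
have [ch0|[w wv]] := set_0Vmem (children v).
  by rewrite expoE sum0 ch0 cards0 big_set0 !addr0; congr taylorz; ring.
have v_end : valency T v = 1%N.
  apply: endT; rewrite in_set vT /=; apply/existsP; exists w.
  have /(childrenP pd)[wN pw _] := wv; have /setDP[wS wT] := wN.
  by have [_ + _] := pd wS wT; rewrite pw adjC wN => ->.
have -> : (valency T v)%:Z + #|children v|%:Z - 2 - #|children v|%:Z = (valency T v)%:Z - 2.
  by ring.
rewrite v_end (_ : 1%N%:Z - 2 = -1) // !taylorz_neg1 (wcoef_expo_ge0 adjC adjI nT wl0 vT).
have l_v := l_ge0 v vS.
suff -> : 0 <= expo S l0 v + \sum_(w in children v) g w (l0 v) by [].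
apply: le_trans l_v _; rewrite !expoE sum0 addr0.
have -> : expo T l v = expo T l0 v.
  rewrite /expo; congr (_ + _ - _); apply: eq_inter => [|u uT _]; exact: lE.
rewrite lerD2l; apply: ler_sum => u /(childrenP pd)[uN pu _].
by rewrite -lE // -pu; apply: coord_le_bound.
Qed.

End Elimination.

Theorem mainTheorem8 (V : finType) (adj : rel V) (e : V -> int)
  (S S' : {set V}) (k : nat) (l' : {ffun V -> int}) :
  symmetric adj -> irreflexive adj ->
  elliptic adj e S -> elliptic adj e S' ->
  S' \proper S -> connectedG adj S' ->
  (forall v, v \in boundary adj S S' -> valency adj S' v = 1%N) ->
  SuppP0j adj e S' k l' ->
  (exists l, piinv adj e S S' l' l) ->
  (\sum_(l \in [set l | piinv adj e S S' l' l]%classic) wcoef adj e S l)%R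
    = wcoef adj e S' l'.
Proof.
move=> adjC adjI ellS ellT ST _ endT [[l'T [l'prec wl']] _] [lw [[lwS [_ wlw]] lwE]].
have TS := proper_sub ST; have nS : negdef adj e S by case: ellS.1.
have cS : connectedG adj S by case: ellS.1.1.
have T0 : (0 < #|S'|)%N by case: ellT.1.1.1.
have [par [d pd]] := exists_parent_fun adjC cS TS T0.
have [g gP] := exists_bound adjC adjI ellS ellT TS pd.
have lw_ge0 v : v \in S -> 0 <= expo adj e S lw v by apply: wcoef_expo_ge0.
rewrite -(partial_weight_core adjC adjI ellS ellT TS pd gP wl' l'T endT lw_ge0 lwE).
have supp_piinv (l : vecZ V) : extensions S' l' S l -> wcoef adj e S l <> 0 ->
    piinv adj e S S' l' l.
  move=> [lT lS] /eqP wl; split=> //; split=> //; split=> // l_neg.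
  by apply: l'prec => v vT; rewrite -lT //; apply/l_neg/(subsetP TS).
have full (l : vecZ V) : partial_weight adj e S S' par g S l = wcoef adj e S l.
  exact: (partial_weight_full adjC adjI ellS pd).
rewrite -(sum_extensions adjC ellS ellT TS pd gP (fun v => erefl (l' v)) l'T).
  rewrite (fsbig_widen _ (extensions S' l' S)).
  - by apply: eq_fsbigr => l _; rewrite full.
  - by move=> l [[lS _] lE].
  by move=> l [l_ext l_pi]; apply: contrapT => wl; apply/l_pi/supp_piinv.
have /card_gt0P[t tT] := T0.
apply: (sub_finite_set _ (@finite_coord_fiber _ adj e adjC adjI S t (l' t) nS cS (subsetP TS _ tT))).
move=> l [[lT lS]]; rewrite /= full => /eqP wl; split=> //; first exact: lT.
by move=> v vS; apply: wcoef_expo_ge0 vS.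
Qed.
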